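(* Let $(\Omega,\mathcal{F})$ be a measurable space, let $m\ge 2$, let $k$ be a positive integer with $k\le m$, and let $n$ be an even positive integer. Let $\mathcal{P}=\sum_{i=1}^m a_i\delta_{\mu_i}$ be a mixture of measures (with $m$ distinct components $\mu_1,\dots,\mu_m$, all weights $a_i>0$) such that $\mu_1,\dots,\mu_m$ are $k$-independent. If $2m-2\le (k-1)(n-1)$, then $\mathcal{P}$ is $n$-determined.
   Context: Let $\mathcal{D}$ be the set of probability measures on the measurable space $(\Omega,\mathcal{F})$, viewed as a subset of the real vector space of finite signed measures on $(\Omega,\mathcal{F})$, and equip $\mathcal{D}$ with its power-set $\sigma$-algebra. A mixture of measures is a probability measure on $\mathcal{D}$ of the form $\mathcal{P}=\sum_{i=1}^m a_i\delta_{\mu_i}$, where $m<\infty$, $\mu_i\in\mathcal{D}$, $a_i>0$, $\sum_{i=1}^m a_i=1$, and $\delta_{\mu}$ is the Dirac measure at $\mu$. Representations are always taken minimal, i.e. the $\mu_i$ are pairwise distinct; the $\mu_i$ are called the (mixture) components and $m$ is the number of components. Two mixtures of measures are equal when they are equal as measures on $\mathcal{D}$. For a positive integer $n$, define $V_n(\mathcal{P})=\sum_{i=1}^m a_i\mu_i^{\times n}$, a probability measure on $(\Omega^{n},\mathcal{F}^{\times n})$ (product $\sigma$-algebra), where $\mu_i^{\times n}$ is the $n$-fold product measure. A mixture of measures $\mathcal{P}$ is $n$-determined if there is no mixture of measures $\mathcal{P}'\ne\mathcal{P}$ on the same space (with any finite number of components) such that $V_n(\mathcal{P}')=V_n(\mathcal{P})$.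 A sequence of vectors $x_1,\dots,x_m$ in a vector space is $k$-independent (where $k\le m$) if every subsequence consisting of $k$ of the vectors is linearly independent. *)

(* Defs.v *)
From HB Require Import structures.
From mathcomp Require Import all_boot all_order all_algebra.
From mathcomp Require Import all_classical all_reals all_analysis giry.

Set Implicit Arguments.
Unset Strict Implicit.
Unset Printing Implicit Defensive.

Import Order.TTheory GRing.Theory Num.Theory.
Import numFieldNormedType.Exports.

Local Open Scope classical_set_scope.
Local Open Scope ring_scope.

Section independence.
Context (R : nzRingType) (V : lmodType R).

(* Subsequences of [x] are given by their index sets, so that repeated vectors
   count as dependent. *)
Definition lin_independent (m : nat) (x : 'I_m -> V) (J : {set 'I_m}) : Prop :=
  forall c : 'I_m -> R,
    \sum_(i in J) c i *: x i = 0 -> forall i, i \in J -> c i = 0.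

Definition k_independent (k m : nat) (x : 'I_m -> V) : Prop :=
  forall J : {set 'I_m}, #|J| = k -> lin_independent x J.

End independence.

(* A finite signed measure is a function on all subsets of [T]; requiring the
   value 0 off the sigma-algebra makes Leibniz equality coincide with equality
   of signed measures. *)
Section signed_measures.
Context d (T : measurableType d) (R : realType).

Definition is_signed_measure (nu : set T -> R) : Prop :=
  [/\ (forall A, ~ measurable A -> nu A = 0),
      nu set0 = 0 &
      semi_sigma_additive (fun A => (nu A)%:E)].

Definition signed_measure_pred : {pred set T -> R} :=
  [pred nu | `[< is_signed_measure nu >]].

Lemma signed_measure_submod_closed : submod_closed signed_measure_pred.
Proof.
split=> [|a u v /asboolP[u1 u0 us] /asboolP[v1 v0 vs]]; apply/asboolP; split=> //.
- move=> F mF tF mUF; rewrite (_ : (fun n => _) = cst 0%E); first exact: cvg_cst.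
  by apply/funext => n; rewrite big1.
- by move=> A nA; rewrite !fctE u1// v1// scaler0 addr0.
- by rewrite !fctE u0 v0 scaler0 addr0.
- move=> F mF tF mUF.
  have fu := us F mF tF mUF; have fv := vs F mF tF mUF.
  have sumE (w : set T -> R) n : (\sum_(0 <= i < n) (w (F i))%:E)%E =
    (\sum_(0 <= i < n) w (F i))%:E by rewrite sumEFin.
  rewrite (_ : (fun n => _) = (fun n =>
    (a%:E * \sum_(0 <= i < n) (u (F i))%:E + \sum_(0 <= i < n) (v (F i))%:E)%E)).
    by rewrite !fctE EFinD EFinM; apply: cvgeD => //; apply: cvgeZl.
  apply/funext => n; rewrite !sumE -EFinM -EFinD; congr EFin.
  by rewrite mulr_sumr -big_split.
Qed.

HB.instance Definition _ :=
  GRing.isSubmodClosed.Build R (set T -> R) signed_measure_pred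
    signed_measure_submod_closed.

Record signed_measure := SignedMeasure {
  smeasure_fun :> set T -> R ;
  _ : smeasure_fun \in signed_measure_pred }.

HB.instance Definition _ := [isSub for smeasure_fun].
HB.instance Definition _ := [Choice of signed_measure by <:].
HB.instance Definition _ := [SubChoice_isSubLmodule of signed_measure by <:].

Lemma smeasureP (nu : signed_measure) : is_signed_measure nu.
Proof. by apply/asboolP; case: nu. Qed.

Lemma smeasure_eq (nu nu' : signed_measure) :
  (forall A, measurable A -> nu A = nu' A) -> nu = nu'.
Proof.
move=> e; apply/val_inj/funext => A /=.
have [mA|nA] := pselect (measurable A); first exact: e.
have [nu0 _ _] := smeasureP nu; have [nu'0 _ _] := smeasureP nu'.
by rewrite nu0// nu'0.
Qed.

End signed_measures.
Arguments signed_measure {d} T R.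

Section distributions.
Context d (T : measurableType d) (R : realType).

Definition is_distr (nu : signed_measure T R) : Prop :=
  (forall A, 0 <= nu A) /\ nu [set: T] = 1.

Record distr := Distr {
  distr_smeasure :> signed_measure T R ;
  _ : `[< is_distr distr_smeasure >] }.

HB.instance Definition _ := [isSub for distr_smeasure].
HB.instance Definition _ := [Choice of distr by <:].

Lemma distrP (mu : distr) : is_distr mu.
Proof. by apply/asboolP; case: mu. Qed.

Definition distr_prob (mu : distr) (A : set T) : \bar R := (mu A)%:E.

Section distr_prob.
Variable mu : distr.

Let distr_prob0 : distr_prob mu set0 = 0%E.
Proof. by rewrite /distr_prob; have [_ ->] := smeasureP mu. Qed.

Let distr_prob_ge0 A : (0 <= distr_prob mu A)%E.
Proof. by rewrite lee_fin; exact: (distrP mu).1. Qed.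

Let distr_prob_sigma : semi_sigma_additive (distr_prob mu).
Proof. by have [] := smeasureP mu. Qed.

HB.instance Definition _ := isMeasure.Build _ _ _ (distr_prob mu)
  distr_prob0 distr_prob_ge0 distr_prob_sigma.

Let distr_prob_setT : distr_prob mu [set: T] = 1%E.
Proof. by rewrite /distr_prob (distrP mu).2. Qed.

HB.instance Definition _ :=
  Measure_isProbability.Build _ _ _ (distr_prob mu) distr_prob_setT.

End distr_prob.

Lemma distr_of_prob (P : probability T R) :
  exists mu : distr, distr_prob mu ≡μ P.
Proof.
pose f (A : set T) := if `[< measurable A >] then fine (P A) else 0.
have fE A : measurable A -> (f A)%:E = P A.
  by move=> mA; rewrite /f asboolT// fineK// fin_num_measure.
have fs : f \in @signed_measure_pred _ T R.
  apply/asboolP; split.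
  - by move=> A nA; rewrite /f asboolF.
  - by apply: EFin_inj; rewrite fE// measure0.
  - move=> F mF tF mUF; rewrite fE//.
    rewrite (_ : (fun n => _) = (fun n => \sum_(0 <= i < n) P (F i))%E).
      exact: measure_semi_sigma_additive.
    by apply/funext => n; apply: eq_bigr => i _; rewrite fE.
have fd : is_distr (SignedMeasure fs).
  split=> [A|/=]; last by apply: EFin_inj; rewrite fE// probability_setT.
  by rewrite /= /f; case: ifP => // _; rewrite fine_ge0.
by exists (Distr (introT (asboolP _) fd)) => A mA; rewrite /= /distr_prob fE.
Qed.

Lemma distr_eq (mu nu : distr) : distr_prob mu ≡μ distr_prob nu -> mu = nu.
Proof.
by move=> e; apply/val_inj/smeasure_eq => A mA; apply: EFin_inj; exact: e.
Qed.

HB.instance Definition _ :=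
  isPointed.Build distr (projT1 (cid (distr_of_prob (\d_(point : T))))).

HB.instance Definition _ := @isMeasurable.Build default_measure_display
  distr discrete_measurable discrete_measurable0
  discrete_measurableC discrete_measurableU.

End distributions.
Arguments distr {d} T R.

Section product_power.
Context d (T : measurableType d) (R : realType) (P : probability T R).

Definition tuple_cons (n : nat) (x : T * n.-tuple T) : n.+1.-tuple T :=
  [the n.+1.-tuple T of x.1 :: x.2].

Lemma measurable_tuple_cons n : measurable_fun [set: T * n.-tuple T] (@tuple_cons n).
Proof. exact: measurable_cons. Qed.

HB.instance Definition _ n :=
  isMeasurableFun.Build _ _ _ _ (@tuple_cons n) (@measurable_tuple_cons n).

Fixpoint prob_power (n : nat) : probability (n.-tuple T) R :=
  match n return probability (n.-tuple T) R with
  | 0 => \d_[tuple]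
  | n'.+1 => distribution (P \x prob_power n')%E (@tuple_cons n')
  end.

Lemma prob_power_box n (A : 'I_n -> set T) : (forall i, measurable (A i)) ->
  prob_power n [set t | forall i, A i (tnth t i)] = (\prod_(i < n) P (A i))%E.
Proof.
elim: n A => [|n IH] A mA.
  rewrite big_ord0 /= /dirac indicE mem_set//=.
  by move=> [].
pose B := [set t : n.-tuple T | forall i, A (lift ord0 i) (tnth t i)].
have mB : measurable B.
  rewrite (_ : B = \bigcap_(i in [set: 'I_n])
      ((fun t => tnth t i) @^-1` A (lift ord0 i))).
    apply: fin_bigcap_measurable => // i _.
    by rewrite -[X in measurable X]setTI; exact: measurable_tnth.
  by apply/seteqP; split=> t /= Bt i; [move=> _|]; exact: Bt.
rewrite big_ord_recl -[X in (_ * X)%E](IH (fun i => A (lift ord0 i)))//.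
rewrite -product_measure1E//= /distribution /pushforward.
congr ((P \x prob_power n)%E _); apply/seteqP; split=> -[x t] /=.
  move=> At; split; first exact: (At ord0).
  by move=> i; have := At (lift ord0 i); rewrite tnthS.
move=> [Ax At] i; have [j ->|->] := unliftP ord0 i; last exact: Ax.
by rewrite tnthS; exact: At.
Qed.

End product_power.

Section convex_combination.
Context d (T : measurableType d) (R : realType) (m : nat).
Variables (a : 'I_m -> R) (P : 'I_m -> probability T R).
Hypotheses (a_ge0 : forall i, 0 <= a i) (a_sum1 : \sum_(i < m) a i = 1).

Definition convex_comb & (forall i, 0 <= a i) & \sum_(i < m) a i = 1 :
    set T -> \bar R :=
  fun A => (\sum_(i < m) (a i)%:E * P i A)%E.

Local Notation comb := (convex_comb a_ge0 a_sum1).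

Let comb0 : comb set0 = 0%E.
Proof. by rewrite /convex_comb big1// => i _; rewrite measure0 mule0. Qed.

Let comb_ge0 A : (0 <= comb A)%E.
Proof. by apply: sume_ge0 => i _; rewrite mule_ge0// lee_fin. Qed.

Let comb_sigma_additive : semi_sigma_additive comb.
Proof.
move=> F mF tF mUF; rewrite /convex_comb.
rewrite (_ : (fun n => _) = (fun n =>
    \sum_(i < m) (a i)%:E * \sum_(0 <= j < n) P i (F j))%E).
  apply: cvg_nnesum => [i _|i _]; last first.
    by apply: cvgeZl => //; exact: measure_semi_sigma_additive.
  by apply: nearW => n; rewrite mule_ge0 ?lee_fin// sume_ge0.
apply/funext => n; rewrite exchange_big; apply: eq_bigr => i _.
by rewrite ge0_sume_distrr.
Qed.

HB.instance Definition _ := isMeasure.Build _ _ _ comb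
  comb0 comb_ge0 comb_sigma_additive.

Let comb_setT : comb [set: T] = 1%E.
Proof.
rewrite /convex_comb -[in RHS]a_sum1 -sumEFin; apply: eq_bigr => i _.
by rewrite probability_setT mule1.
Qed.

HB.instance Definition _ :=
  Measure_isProbability.Build _ _ _ comb comb_setT.

End convex_combination.

Section mixtures.
Context d (T : measurableType d) (R : realType).

(* A minimal representation with [m] components. *)
Record mixture (m : nat) := Mixture {
  weight : 'I_m -> R ;
  component : 'I_m -> distr T R ;
  weight_gt0 : forall i, 0 < weight i ;
  weight_sum1 : \sum_(i < m) weight i = 1 ;
  component_inj : injective component }.

Definition mixture_measure m (Q : mixture m) : probability (distr T R) R :=
  convex_comb (fun i => \d_(component Q i))
    (fun i => ltW (weight_gt0 Q i)) (weight_sum1 Q).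

Definition V (n m : nat) (Q : mixture m) : probability (n.-tuple T) R :=
  convex_comb (fun i => prob_power (distr_prob (component Q i)) n)
    (fun i => ltW (weight_gt0 Q i)) (weight_sum1 Q).

(* Measures in the library also take values on non-measurable sets, so they are
   compared with [≡μ], which only looks at measurable sets (on [distr T R],
   these are all sets). *)
Definition n_determined (n m : nat) (Q : mixture m) : Prop :=
  ~ exists (m' : nat) (Q' : mixture m'),
      ~ (mixture_measure Q' ≡μ mixture_measure Q) /\ V n Q' ≡μ V n Q.

End mixtures.
Arguments mixture {d} T R m.

(* Main.v *)
(* Write [V_n] as a functional on "tests", the linear combinations of products
   [z |-> z A_1 * ... * z A_p] of evaluations at measurable sets.  Let [n = 2 p]
   and [V_n P' = V_n P].  If a test [f] of degree [p] vanishes at all components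
   of [P], then integrating [f ^ 2], a nonnegative test of degree [n], shows that
   it vanishes at every component [nu] of [P'].  Since [m <= p (k - 1) + 1],
   products of linear functionals each killing [k - 1] components give tests
   [g_i] of degree [p] dual to the components [mu_i]; hence
   [f nu = \sum_i g_i nu * f mu_i] for all tests [f] of degree [p].  For
   [i != j] and [k - 2] other components, some linear functional kills these and
   [nu] but not both of [mu_i] and [mu_j]; multiplied by a test of degree [p - 1]
   it gives [g_i nu = 0] or [g_j nu = 0].  So only one coefficient survives, and
   [nu] is one of the [mu_i].  The weights then agree because there are tests of
   degree [n] dual to the [mu_i]. *)
Require Import Defs.
From mathcomp Require Import all_boot all_order all_algebra.
From mathcomp Require Import all_classical all_reals all_analysis giry.
From mathcomp Require Import zify ring.

Set Implicit Arguments.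
Unset Strict Implicit.
Unset Printing Implicit Defensive.

Import Order.TTheory GRing.Theory Num.Theory.

Local Open Scope classical_set_scope.
Local Open Scope ring_scope.

(** * Subsets of prescribed size and linear independence *)

Lemma subset_card_between (I : finType) (A B : {set I}) (r : nat) :
  A \subset B -> (#|A| <= r <= #|B|)%N ->
  exists C : {set I}, [/\ A \subset C, C \subset B & #|C| = r].
Proof.
move=> AB /andP[Ar rB].
have /card_geqP[s [us ss sBA]] : (r - #|A| <= #|B :\: A|)%N.
  by rewrite cardsD (finset.setIidPr AB) leq_sub2r.
exists (A :|: [set x in s]); split.
- exact: finset.subsetUl.
- apply/fintype.subsetP => x; rewrite finset.in_setU finset.in_set.
  by case/orP => [/(fintype.subsetP AB)//|/sBA]; rewrite finset.in_setD => /andP[].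
- rewrite cardsU cardsE (card_uniqP us) ss (_ : _ :&: _ = finset.set0).
    by rewrite cards0 subn0 subnKC.
  apply/finset.setP => x; rewrite finset.in_setI !finset.in_set.
  by apply/negP => /andP[xA /sBA]; rewrite finset.in_setD xA.
Qed.

Lemma lin_independentS (R : nzRingType) (W : lmodType R) (m : nat) (x : 'I_m -> W)
    (J K : {set 'I_m}) :
  J \subset K -> lin_independent x K -> lin_independent x J.
Proof.
move=> JK xK c c0 i iJ.
have := xK (fun j => if j \in J then c j else 0) _ i (fintype.subsetP JK i iJ).
rewrite iJ; apply; rewrite -[RHS]c0 (finset.big_setID J)/= (finset.setIidPr JK).
rewrite [X in _ + X]big1 ?addr0 => [|j]; first by apply: eq_bigr => j ->.
by rewrite finset.in_setD => /andP[/negbTE-> _]; rewrite scale0r.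
Qed.

(** * The calculus of tests *)

Section tests.
Context d (T : measurableType d) (R : realType).
Implicit Types (z : signed_measure T R) (f g : signed_measure T R -> R).

(** Kept as plain functions indexed by degree; building products one evaluation at a time lets
    inductions peel off one factor at a time. *)
Inductive test : nat -> (signed_measure T R -> R) -> Prop :=
| test_one : test 0 (fun=> 1)
| test_eval A p f : measurable A -> test p f -> test p.+1 (fun z => z A * f z)
| test_lin w p f g : test p f -> test p g -> test p (fun z => w * f z + g z).

Lemma test_scale w p f : test p f -> test p (fun z => w * f z).
Proof.
(* The constructors give no zero test, so [w * f] is obtained as [(w - 1) * f + f]. *)
move=> tf; have := test_lin (w - 1) tf tf.
by congr test; apply/funext => z; ring.
Qed.

(** The extra summand [g] covers the empty sum. *)
Lemma test_sum p (I : Type) (r : seq I) (Q : pred I) (w : I -> R)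
    (f : I -> signed_measure T R -> R) g :
  test p g -> (forall i, test p (f i)) ->
  test p (fun z => \sum_(i <- r | Q i) w i * f i z + g z).
Proof.
move=> tg tf; elim: r => [|i r IH].
  by move: tg; congr test; apply/funext => z; rewrite big_nil add0r.
have [Qi|Qi] := boolP (Q i); last first.
  by move: IH; congr test; apply/funext => z; rewrite big_cons (negbTE Qi).
have := test_lin (w i) (tf i) IH.
by congr test; apply/funext => z; rewrite big_cons Qi addrA.
Qed.

Lemma test_mul p q f g : test p f -> test q g -> test (p + q) (fun z => f z * g z).
Proof.
move=> tf tg; elim: tf => {p f} [|A p f mA _ IH|w p f f' _ IH _ IH'].
- by move: tg; congr test; apply/funext => z; rewrite mul1r.
- by have := test_eval mA IH; congr test; apply/funext => z; rewrite mulrA.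
- by have := test_lin w IH IH'; congr test; apply/funext => z; ring.
Qed.

(** A power of the total mass; it raises degrees without changing values at probability measures. *)
Lemma test_mass p : exists2 f, test p f &
  forall mu : distr T R, f (distr_smeasure mu) = 1.
Proof.
elim: p => [|p [f tf f1]]; first by exists (fun=> 1) => //; exact: test_one.
exists (fun z => z setT * f z); first exact: test_eval.
by move=> mu; rewrite f1 (distrP mu).2 mulr1.
Qed.

Lemma test1_linear f : test 1 f -> linear_for *%R f.
Proof.
(* An evaluation times a test of degree 0 is linear because the latter is constant, so degrees 0 and
   1 are treated together. *)
suff homog p : test p f ->
    (p = 0%N -> exists c, f = fun=> c) /\ (p = 1%N -> linear_for *%R f).
  by move=> /homog[_]; apply.
elim=> {p f} [|A p f mA _ [cf _]|w p f f' _ [cf lf] _ [cf' lf']].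
- by split=> // _; exists 1.
- split=> // -[p0] a u v; have [c ->] := cf p0.
  by rewrite /= mulrDl mulrA.
- split=> [p0|p1 a u v].
    by have [[c ->] [c' ->]] := (cf p0, cf' p0); exists (w * c + c').
  by rewrite lf// lf'//; ring.
Qed.

Lemma test1_sum f (I : Type) (r : seq I) (Q : pred I) (c : I -> R)
    (v : I -> signed_measure T R) : test 1 f ->
  f (\sum_(i <- r | Q i) c i *: v i) = \sum_(i <- r | Q i) c i * f (v i).
Proof.
move=> /test1_linear lf; elim: r => [|i r IH].
  by rewrite !big_nil; have := lf (-1) 0 0; rewrite scaler0 addr0 mulN1r addNr.
by rewrite !big_cons; case: ifP => // _; rewrite lf IH.
Qed.

(** * Dual tests *)

Lemma signed_measure_neq0 z : z <> 0 -> exists2 A, measurable A & z A != 0.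
Proof.
move=> z0; apply: contrapT => nA; apply: z0; apply: smeasure_eq => A mA.
by apply: contrapT => /eqP zA; apply: nA; exists A.
Qed.

(** Induction on [#|J|]: by independence, [x i] minus its projection given by the dual tests of the
    other vectors is nonzero, so some evaluation detects it. Correcting this evaluation by those
    dual tests makes it vanish at the other vectors. *)
Lemma lin_independent_dual (m : nat) (x : 'I_m -> signed_measure T R) (J : {set 'I_m}) i :
  lin_independent x J -> i \in J ->
  exists2 f, test 1 f & f (x i) = 1 /\ forall j, j \in J -> j != i -> f (x j) = 0.
Proof.
have [r] := ubnP #|J|; elim: r J i => // r IH J i; rewrite ltnS => cJ xJ iJ.
have /fin_all_exists2[g tg gx] : forall j, exists2 f, test 1 f &
    j \in J :\ i -> f (x j) = 1 /\ forall l, l \in J :\ i -> l != j -> f (x l) = 0.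
  move=> j; have [jJ|_] := boolP (j \in J :\ i); last first.
    by have [f tf _] := test_mass 1; exists f.
  have [||f tf fx] := IH (J :\ i) j _ _ jJ.
  - by move: cJ; rewrite (cardsD1 i) iJ.
  - exact: lin_independentS (finset.subsetDl _ _) xJ.
  - by exists f.
pose w := - 1 *: (\sum_(j in J :\ i) g j (x i) *: x j) + x i.
have /signed_measure_neq0[A mA wA] : w <> 0.
  move=> w0; have := xJ (fun j => if j == i then 1 else - g j (x i)) _ i iJ.
  rewrite eqxx => c1; apply: (elimN eqP (oner_neq0 R)); apply: c1.
  rewrite (finset.big_setD1 i)//= eqxx scale1r addrC -[RHS]w0; congr (_ + _).
  rewrite scaleN1r -sumrN; apply: eq_bigr => j.
  by rewrite finset.in_setD1 => /andP[/negbTE-> _]; rewrite scaleNr.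
pose ev z := z A * 1.
have tev : test 1 ev by exact: test_eval mA test_one.
pose h z := \sum_(j in J :\ i) - ev (x j) * g j z + ev z.
have th : test 1 h by exact: test_sum.
have hxi : h (x i) = w A.
  rewrite -[w A]mulr1 -/(ev w) (test1_linear tev) (test1_sum _ _ _ _ tev).
  by congr (_ + _); rewrite mulN1r -sumrN; apply: eq_bigr => j _; ring.
exists (fun z => (w A)^-1 * h z); first exact: test_scale.
rewrite hxi mulVf//; split=> // j jJ ji.
have jJi : j \in J :\ i by rewrite finset.in_setD1 ji.
rewrite /h (finset.big_setD1 j)//= (gx j jJi).1 mulr1 [X in _ + X + _]big1 => [|l].
  by rewrite addr0 addNr mulr0.
rewrite finset.in_setD1 => /andP[lj lJ].
by rewrite (gx l lJ).2// ?mulr0// eq_sym.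
Qed.

(** Each linear factor is 1 at [x i] and kills up to [k] further points of [J], so [p] factors
    handle [p * k] points besides [x i]. *)
Lemma test_dual (m k p : nat) (x : 'I_m -> signed_measure T R) (J : {set 'I_m}) i :
  (k < m)%N -> k_independent k.+1 x -> (#|J| <= (p * k).+1)%N -> i \in J ->
  exists2 f, test p f & f (x i) = 1 /\ forall j, j \in J -> j != i -> f (x j) = 0.
Proof.
move=> km xk; elim: p J => [|p IH] J cJ iJ.
  exists (fun=> 1); first exact: test_one.
  split=> // j jJ ji; suff : (1 < #|J|)%N by rewrite ltnNge cJ.
  by apply/card_gt1P; exists j, i.
have cJi : #|J| = #|J :\ i|.+1 by rewrite (cardsD1 i J) iJ.
have [G [_ GJ cG]] := @subset_card_between _ finset.set0 (J :\ i) (minn k #|J :\ i|)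
  (finset.sub0set _) ltac:(by rewrite cards0 geq_minr).
have iG : i \notin G by apply/negP => /(fintype.subsetP GJ); rewrite finset.setD11.
(* Independence is given for exactly [k.+1] vectors, so [i |: G] is enlarged to that size; [k < m]
   leaves room. *)
have [K [GK _ cK]] := @subset_card_between _ (i |: G) finset.setT k.+1
  (finset.subsetT _) ltac:(by rewrite cardsU1 iG cG cardsT card_ord; lia).
have [] := lin_independent_dual (lin_independentS GK (xk K cK)) (finset.setU11 i G).
move=> f tf [fi fG].
have GJ' : G \subset J by exact: fintype.subset_trans GJ (finset.subsetDl _ _).
have [] := IH (J :\: G).
- by rewrite cardsD (finset.setIidPr GJ') cG; lia.
- by rewrite finset.in_setD iG.
move=> g tg [gi gJ]; exists (fun z => f z * g z); first exact: (test_mul tf tg).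
rewrite fi gi mulr1; split=> // j jJ ji; have [jG|jG] := boolP (j \in G).
  by rewrite fG ?mul0r// finset.in_setU jG orbT.
by rewrite gJ ?mulr0// finset.in_setD jG.
Qed.

(** * Recovering the components *)

Lemma test_vanish (m m' p : nat) (a : 'I_m -> R) (b : 'I_m' -> R)
    (x : 'I_m -> signed_measure T R) (y : 'I_m' -> signed_measure T R) :
  (forall j, 0 < b j) ->
  (forall f, test (p + p) f -> \sum_j b j * f (y j) = \sum_i a i * f (x i)) ->
  forall f, test p f -> (forall i, f (x i) = 0) -> forall j, f (y j) = 0.
Proof.
move=> b0 xy f tf fx j.
have := xy _ (test_mul tf tf); rewrite [RHS]big1 => [|i _]; last first.
  by rewrite fx !mulr0.
move/eqP; rewrite psumr_eq0 => [|l _]; last first.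
  by rewrite mulr_ge0 ?(ltW (b0 l))// -expr2 sqr_ge0.
move=> /allP/(_ j (mem_index_enum j)).
by rewrite mulf_eq0 gt_eqF//= mulf_eq0 orbb => /eqP.
Qed.

(** Some nontrivial combination of the functionals dual to [x i] and [x j] vanishes at [y]. *)
Lemma k_independent_separate (m k : nat) (x : 'I_m -> signed_measure T R)
    (K : {set 'I_m}) i j (y : signed_measure T R) :
  k_independent k.+2 x -> #|K| = k -> i \notin K -> j \notin K -> i != j ->
  exists f, [/\ test 1 f, f y = 0, forall l, l \in K -> f (x l) = 0 &
    f (x i) != 0 \/ f (x j) != 0].
Proof.
move=> xk cK iK jK ij; pose J := i |: (j |: K).
have iJK : i \notin j |: K by rewrite finset.in_setU1 negb_or ij.
have xJ : lin_independent x J by apply: xk; rewrite !cardsU1 iJK jK cK.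
have iJ : i \in J by exact: finset.setU11.
have jJ : j \in J by rewrite !finset.inE eqxx orbT.
have KJ l : l \in K -> [/\ l \in J, l != i & l != j].
  move=> lK; rewrite !finset.inE lK !orbT; split=> //.
    by apply: contraNneq iK => <-.
  by apply: contraNneq jK => <-.
have [f tf [fi f0]] := lin_independent_dual xJ iJ.
have [g tg [gj g0]] := lin_independent_dual xJ jJ.
have ji : j != i by rewrite eq_sym.
have [fy|fy] := eqVneq (f y) 0.
  exists f; split=> // [l /KJ[lJ li _]|]; first exact: f0.
  by left; rewrite fi oner_neq0.
exists (fun z => - g y * f z + f y * g z); split.
- exact: test_lin tf (test_scale _ tg).
- by ring.
- by move=> l /KJ[lJ li lj]; rewrite f0// g0// !mulr0 addr0.
- by right; rewrite gj f0// mulr0 add0r mulr1.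
Qed.

Lemma vanish_component (m k p : nat) (mu : 'I_m -> distr T R) (nu : distr T R) :
  let x i := distr_smeasure (mu i) in
  (k.+1 < m)%N -> k_independent k.+2 x -> (m <= p.+1 * k.+1)%N ->
  (forall f, test p.+1 f -> (forall i, f (x i) = 0) -> f (distr_smeasure nu) = 0) ->
  exists i, nu = mu i.
Proof.
move=> x km xk mpk vanish.
have /fin_all_exists2[g tg gx] : forall i, exists2 f, test p.+1 f &
    f (x i) = 1 /\ forall j, j != i -> f (x j) = 0.
  move=> i.
  have [|f tf [fi f0]] := @test_dual m k.+1 p.+1 x finset.setT i km xk _ (finset.in_setT i).
    by rewrite cardsT card_ord; lia.
  by exists f => //; split=> // j; apply: f0.
pose c i := g i (distr_smeasure nu).
(* The test [f - \sum_i f (x i) * g i] vanishes at every component, hence at [nu]. *)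
have fnu f : test p.+1 f -> f (distr_smeasure nu) = \sum_i f (x i) * c i.
  move=> tf; have /eqP : \sum_i - f (x i) * c i + f (distr_smeasure nu) = 0.
    apply: (vanish _ (test_sum _ predT (fun i => - f (x i)) tf tg)) => i.
    rewrite (bigD1 i)//= (gx i).1 mulr1 big1 ?addr0 ?addNr// => j ji.
    by rewrite (gx j).2 ?mulr0// eq_sym.
  rewrite addrC addr_eq0 => /eqP->; rewrite -sumrN.
  by apply: eq_bigr => i _; rewrite mulNr opprK.
have c_unique i j : i != j -> c i != 0 -> c j = 0.
  move=> ij ci; apply/eqP; apply: contraTT isT => cj.
  have [K [_ KC cK]] := @subset_card_between _ finset.set0 (~: [set i; j]%SET) k
    (finset.sub0set _) ltac:(by have := cardsC [set i; j]%SET; rewrite cards0 cards2 ij card_ord; lia).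
  have notK l : l \in [set i; j]%SET -> l \notin K.
    by apply: contraL => /(fintype.subsetP KC); rewrite finset.in_setC.
  have iK : i \notin K by apply: notK; rewrite finset.set21.
  have jK : j \notin K by apply: notK; rewrite finset.set22.
  have [f [tf fy fK fij]] := k_independent_separate (distr_smeasure nu) xk cK iK jK ij.
  (* With [h] dual to [l] off [K], the product [f * h] vanishes at [nu] and at all components but
     [l], so [fnu] yields [f (x l) * c l = 0]. *)
  suff c0 l : l \notin K -> c l != 0 -> f (x l) = 0.
    by case: fij => /negP[]; rewrite c0.
  move=> lK cl.
  (* From [m <= p.+1 * k.+1], the complement of [K] has [m - k <= p * k.+1 + 1] elements, exactly
     the allowance in degree [p]. *)
  have [||h th [hl h0]] := @test_dual m k.+1 p x (~: K) l km xk.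
  - have := cardsC K; rewrite card_ord cK -(leq_add2l k) => ->; lia.
  - by rewrite finset.in_setC.
  have := fnu _ (test_mul tf th); rewrite fy mul0r (bigD1 l)//= big1 => [|u ul].
    by rewrite hl mulr1 addr0 => /esym/eqP; rewrite mulf_eq0 (negbTE cl) orbF => /eqP.
  have [uK|uK] := boolP (u \in K); first by rewrite fK// !mul0r.
  by rewrite h0// ?finset.in_setC// mulr0 mul0r.
(* Applied to [e], [fnu] says that the [c i] sum to 1, so one of them is nonzero. *)
have [e te e1] := test_mass p.+1.
have [i ci] : exists i, c i != 0.
  apply: contrapT => nc; have := fnu _ te; rewrite e1 big1.
    by move/eqP; rewrite oner_eq0.
  move=> i _; apply/eqP; rewrite mulf_eq0; apply/orP; right.
  by apply: contrapT => ci; apply: nc; exists i; apply/negP.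
have fnui f : test p.+1 f -> f (distr_smeasure nu) = f (x i) * c i.
  move=> /fnu->; rewrite (bigD1 i)//= big1 ?addr0// => j ji.
  by rewrite (c_unique i j) ?mulr0// eq_sym.
have ci1 : c i = 1 by have := fnui _ te; rewrite !e1 mul1r.
exists i; apply/val_inj/smeasure_eq => A mA.
have [e' te' e'1] := test_mass p.
by have := fnui _ (test_eval mA te'); rewrite !e'1 ci1 !mulr1.
Qed.

(** * Integrating tests against [V n] *)

Lemma V_test (n m m' : nat) (Q : mixture T R m) (Q' : mixture T R m') f :
  V n Q' ≡μ V n Q -> test n f ->
  \sum_j weight Q' j * f (distr_smeasure (component Q' j)) =
  \sum_i weight Q i * f (distr_smeasure (component Q i)).
Proof.
move=> VQ.
have VE l (S : mixture T R l) (A : n.-tuple (set T)) :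
    (forall i, measurable (tnth A i)) ->
    V n S [set t | forall i, tnth A i (tnth t i)] =
    (\sum_i weight S i * \prod_(B <- A) distr_smeasure (component S i) B)%:E.
  move=> mA; rewrite /V/= /convex_comb -sumEFin; apply: eq_bigr => i _.
  rewrite prob_power_box// EFinM; congr (_ * _)%E.
  by rewrite big_tuple prodEFin.
have box (A : seq (set T)) : size A = n -> (forall B, B \in A -> measurable B) ->
    \sum_j weight Q' j * \prod_(B <- A) distr_smeasure (component Q' j) B =
    \sum_i weight Q i * \prod_(B <- A) distr_smeasure (component Q i) B.
  move=> sA mA; apply: EFin_inj.
  have mtA i : measurable (tnth (tcast sA (in_tuple A)) i).
    by apply: mA; rewrite tcastE; exact: mem_tnth.
  have := VE _ Q' _ mtA; have := VE _ Q _ mtA.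
  rewrite val_tcast => <- <-; apply: VQ.
  rewrite (_ : [set _ | _] = \bigcap_(i in [set: 'I_n])
      ((fun t => tnth t i) @^-1` (tnth (tcast sA (in_tuple A)) i))).
    apply: fin_bigcap_measurable => // i _.
    by rewrite -[X in measurable X]setTI; exact: measurable_tnth.
  by apply/seteqP; split=> t /= At i; [move=> _|]; exact: At.
(* The list [A] collects the evaluations already stripped from the test; in degree 0 only the box
   with sides [A] remains. *)
suff gen p : test p f -> forall A, (p + size A)%N = n ->
    (forall B, B \in A -> measurable B) ->
    \sum_j weight Q' j * (f (distr_smeasure (component Q' j)) *
      \prod_(B <- A) distr_smeasure (component Q' j) B) =
    \sum_i weight Q i * (f (distr_smeasure (component Q i)) *
      \prod_(B <- A) distr_smeasure (component Q i) B).
  move=> tf; apply: etrans (etrans _ (gen n tf [::] (addn0 n) _)) _ => //.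
    by apply: eq_bigr => j _; rewrite big_nil mulr1.
  by apply: eq_bigr => i _; rewrite big_nil mulr1.
elim=> {p f} [|B p f mB _ IH|w p f f' _ IH _ IH'] A sA mA.
- by under eq_bigr do rewrite mul1r; under [RHS]eq_bigr do rewrite mul1r; exact: box.
- have sBA : (p + size (B :: A))%N = n by rewrite -sA addnS addSn.
  have mBA C : C \in B :: A -> measurable C.
    by rewrite in_cons => /predU1P[->//|]; exact: mA.
  apply: etrans (etrans _ (IH _ sBA mBA)) _.
    by apply: eq_bigr => j _; rewrite big_cons; ring.
  by apply: eq_bigr => i _; rewrite big_cons; ring.
- have dist l (S : mixture T R l) : \sum_i weight S i *
      ((w * f (distr_smeasure (component S i)) + f' (distr_smeasure (component S i))) *
       \prod_(B <- A) distr_smeasure (component S i) B) =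
      w * (\sum_i weight S i * (f (distr_smeasure (component S i)) *
       \prod_(B <- A) distr_smeasure (component S i) B)) +
      \sum_i weight S i * (f' (distr_smeasure (component S i)) *
       \prod_(B <- A) distr_smeasure (component S i) B).
    by rewrite mulr_sumr -big_split; apply: eq_bigr => i _ /=; ring.
  by rewrite !dist IH// IH'.
Qed.

End tests.

(** * Comparison of the two mixtures *)

Theorem theorem4p2 (R : realType) (d : measure_display) (Omega : measurableType d)
    (m k n : nat) (P : mixture Omega R m) :
  (2 <= m)%N -> (0 < k)%N -> (k <= m)%N -> (0 < n)%N -> ~~ odd n ->
  k_independent k (fun i => distr_smeasure (component P i)) ->
  (2 * m - 2 <= (k - 1) * (n - 1))%N ->
  n_determined n P.
Proof.
move=> m2 k0 km n0 even_n xk bound [m' [Q [neq VQ]]]; apply: neq => B _.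
have [r nE] : exists r, n = (r.+1 + r.+1)%N.
  exists (n./2).-1; rewrite addnn prednK ?even_halfK//.
  by rewrite half_gt0; case: (n) n0 even_n => [|[]].
(* [k = 1] would force [2 * m - 2 <= 0]; from here on the order of independence is [k.+2]. *)
case: k k0 km xk bound => [//|[|k]] _ km xk bound; first by lia.
(* The bound gives [m <= r.+1 * k.+1 + 1 - k.+1 / 2] over the rationals; the excess is at most 1/2
   and integrality removes it. *)
have mrk : (m <= r.+1 * k.+1)%N by nia.
have Vf f (tf : test n f) := V_test VQ tf.
rewrite nE in Vf.
have vanish := test_vanish (weight_gt0 Q) Vf.
have /fin_all_exists[s sE] : forall j, exists i, component Q j = component P i.
  move=> j; apply: (vanish_component km xk mrk) => f tf fx; exact: vanish.
(* Dirac masses of [Q] at the same component of [P] add up, so equal total weights over the fibers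
   of [s] suffice. *)
have fiber i : \sum_(j | s j == i) weight Q j = weight P i.
  have [|g tg [gi g0]] := @test_dual _ _ _ m k.+1 n _ finset.setT i km xk _ (finset.in_setT i).
    by rewrite cardsT card_ord; nia.
  have := V_test VQ tg; rewrite (bigD1 i)//= gi mulr1 [X in _ + X]big1 ?addr0 => [<-|j ji].
    rewrite big_mkcond; apply: eq_bigr => j _; rewrite sE; case: eqP => [->|/eqP ji].
      by rewrite gi mulr1.
    by rewrite g0// mulr0.
  by rewrite g0// mulr0.
rewrite /mixture_measure/= /convex_comb.
rewrite (partition_big s predT)//=; apply: eq_bigr => i _.
rewrite -fiber -sumEFin ge0_sume_distrl => [|j _]; last first.
  by rewrite lee_fin ltW// weight_gt0.
by apply: eq_bigr => j /eqP <-; rewrite sE.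
Qed.
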